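(* For every positive integer $n$, $$p(n,n)\ge 5^{\lfloor n/2\rfloor-2}.$$
   Context: For positive integers $m,n$, let $R=[0,m]\times[0,n]\subset\mathbb{R}^2$. All rectangles have sides parallel to the coordinate axes. A partition of the rectangle $R$ is a multiset of rectangles $\{R_i\}_{i\in I}$ such that: (1) each $R_i$ has positive integer side lengths; (2) rectangles of sizes $k\times l$ and $l\times k$ are regarded as indistinguishable; (3) all the rectangles of the multiset can be arranged so that they cover exactly $R$ and their interiors are pairwise disjoint. Two partitions are the same if they are equal as multisets (of rectangle types, up to rotation); the geometric arrangement is irrelevant. $p(m,n)$ denotes the number of partitions of the $m\times n$ rectangle. *)

(* Defs.v *)
From mathcomp Require Import all_boot all_order all_algebra.
From mathcomp Require Import finmap multiset.
From mathcomp Require Import all_classical all_reals all_analysis.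

Set Implicit Arguments.
Unset Strict Implicit.
Unset Printing Implicit Defensive.

Import Order.TTheory GRing.Theory Num.Theory.
Import numFieldNormedType.Exports.

Local Open Scope classical_set_scope.
Local Open Scope ring_scope.

Definition rect (R : realType) (x y : R) (w h : nat) : set (R * R) :=
  `[x, x + w%:R] `*` `[y, y + h%:R].

(* The unordered pair {k, l}, represented by its sorted pair, so that k x l and
   l x k are the same type. *)
Definition rect_type (k l : nat) : nat * nat := (minn k l, maxn k l).

(* The tile with index i is placed with lower left corner (x i, y i), as a
   rectangle of width w i and height h i; this accounts for both orientations
   of each type. The corners are arbitrary real points. *)
Definition is_partition (R : realType) (m n : nat) (D : {mset nat * nat}%mset) :
    Prop :=
  exists (N : nat) (w h : 'I_N -> nat) (x y : 'I_N -> R),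
    [/\ forall i, (0 < w i)%N /\ (0 < h i)%N,
        D = seq_mset [seq rect_type (w i) (h i) | i <- enum 'I_N],
        \bigcup_i rect (x i) (y i) (w i) (h i) = rect 0 0 m n &
        trivIset setT (fun i => (rect (x i) (y i) (w i) (h i))°)].

(* fset_set A is empty when A is infinite; the set below is finite, since every
   tile has area at least 1. *)
Definition num_partitions (R : realType) (m n : nat) : nat :=
  #|` fset_set [set D | is_partition R m n D]|%fset.

(* Main.v *)
Require Import Defs.
From mathcomp Require Import all_boot all_order all_algebra.
From mathcomp Require Import finmap multiset.
From mathcomp Require Import all_classical all_reals all_analysis.
From mathcomp Require Import zify lra.

Set Implicit Arguments.
Unset Strict Implicit.
Unset Printing Implicit Defensive.

Import Order.TTheory GRing.Theory Num.Theory numFieldNormedType.Exports.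

Local Open Scope classical_set_scope.
Local Open Scope ring_scope.

(** Put [k = n %/ 2 - 1], or [k = 0] if [n = 1], and consider the bricks of
    sizes [1 x l] with [2 <= l <= k + 1]; two bricks of the same size fit end to
    end into a row of length [n] and height 1, because [2 * l <= n].  Reserve two
    rows of the [n x n] square for each of these [k] lengths.  Between them they
    can hold any number of bricks from 0 to 4, and these numbers can be chosen
    independently for different lengths.  Filling everything else with unit
    squares gives a partition in which the multiplicities of the [1 x l] tiles
    are the chosen numbers, so different choices give different multisets
    ([digit_mset_inj]), and [5 ^ k <= p(n, n)], a factor of 5 or more better than required.

    Two facts about real rectangles support this count.  Tilings can be stacked
    and transposed ([is_partition_stack], [is_partition_tr]), which turns any
    stack of rows cut into bricks into a partition ([is_partition_rows]).  And
    a rectangle has only finitely many partitions ([finite_partitions]), so that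
    the cardinality [num_partitions] counts them all: rounding down the
    coordinates of the lower left corners sends distinct tiles to distinct cells
    of the integer grid, hence there are at most [m * n] tiles. *)

(** * Real rectangles and multisets *)

Lemma interior_setX (T U : topologicalType) (A : set T) (B : set U) :
  (A `*` B)° = A° `*` B°.
Proof.
apply/seteqP; split=> [[a b]|[a b] /= [Aa Bb]].
  move=> [[P Q] /= [Pa Qb] PQ]; split.
  - apply: filterS Pa => a' Pa'; have := PQ (a', b) (conj Pa' (nbhs_singleton Qb)).
    by case.
  - apply: filterS Qb => b' Qb'; have := PQ (a, b') (conj (nbhs_singleton Pa) Qb').
    by case.
by exists (A, B).
Qed.

Lemma seq_mset_cat (K : choiceType) (s t : seq K) :
  seq_mset (s ++ t) = (seq_mset s `+` seq_mset t)%mset.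
Proof. by apply/msetP => a; rewrite msetE2 !mset_seqE count_cat. Qed.

(** Multiplicities as sums over the index type: in this form they split along
    the two blocks of an index set ['I_(N1 + N2)]. *)
Lemma seq_mset_ordE (K : choiceType) N (f : 'I_N -> K) (a : K) :
  seq_mset [seq f i | i <- enum 'I_N] a = (\sum_(i < N) (f i == a))%N.
Proof.
by rewrite mset_seqE count_map -sum1_count big_enum_cond /= big_mkcond.
Qed.

Section Tilings.
Variable R : realType.
Implicit Types (x y : R) (p : R * R).

Lemma rectP x y w h p : rect x y w h p <->
  [/\ x <= p.1, p.1 <= x + w%:R, y <= p.2 & p.2 <= y + h%:R].
Proof.
rewrite /rect /= !in_itv /=; split=> [[/andP[? ?] /andP[? ?]]|[-> -> -> ->]] //.
Qed.

Lemma interior_rectP x y w h p : (rect x y w h)° p <->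
  [/\ x < p.1, p.1 < x + w%:R, y < p.2 & p.2 < y + h%:R].
Proof.
rewrite interior_setX !interior_itv /= !in_itv /=.
by split=> [[/andP[? ?] /andP[? ?]]|[-> -> -> ->]].
Qed.

(** The topology enters the definition only through interiors, which
    [interior_rectP] makes explicit; with points instead of sets, what remains
    to check about a tiling is linear arithmetic on coordinates. *)
Lemma is_partitionP m n D : is_partition R m n D <->
  exists (N : nat) (w h : 'I_N -> nat) (x y : 'I_N -> R),
    [/\ forall i, (0 < w i)%N /\ (0 < h i)%N,
        D = seq_mset [seq rect_type (w i) (h i) | i <- enum 'I_N],
        forall p, (exists i, rect (x i) (y i) (w i) (h i) p) <-> rect 0 0 m n p &
        forall i j p, (rect (x i) (y i) (w i) (h i))° p ->
          (rect (x j) (y j) (w j) (h j))° p -> i = j].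
Proof.
split=> -[N [w [h [x [y [wh0 DE cov disj]]]]]]; exists N, w, h, x, y; split=> //.
- move=> p; rewrite -cov; split=> [[i ip]|[i _ ip]]; first by exists i.
  by exists i.
- by move=> i j p ip jp; apply: disj => //; exists p.
- apply/seteqP; split=> p; first by case=> i _ ip; apply/cov; exists i.
  by move=> /cov[i ip]; exists i.
- by move=> i j _ _ [p [ip jp]]; apply: disj ip jp.
Qed.

(** Inclusion need only be tested at the two extreme corners. *)
Lemma rect_le x y w h m n : rect x y w h `<=` rect 0 0 m n ->
  [/\ 0 <= x, x + w%:R <= m%:R, 0 <= y & y + h%:R <= n%:R].
Proof.
move=> sub; have w0 : 0 <= w%:R :> R by []; have h0 : 0 <= h%:R :> R by [].
have /rectP[/=] : rect 0 0 m n (x, y) by apply/sub/rectP; split=> /=; lra.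
have /rectP[/=] : rect 0 0 m n (x + w%:R, y + h%:R).
  by apply/sub/rectP; split=> /=; lra.
rewrite !add0r; split=> //.
Qed.

(** * Building tilings *)

Lemma is_partition1 m n : (0 < m)%N -> (0 < n)%N ->
  is_partition R m n (seq_mset [:: rect_type m n]).
Proof.
move=> m0 n0; apply/is_partitionP.
exists 1%N, (fun=> m), (fun=> n), (fun=> 0), (fun=> 0); split=> //.
- by rewrite enum_ordSl /= enum_ord0.
- by move=> p; split=> [[]|] //; exists ord0.
- by move=> i j; rewrite !ord1.
Qed.

(** Reflecting a tiling in the diagonal turns every tile by a right angle, which
    does not change its type. *)
Lemma is_partition_tr m n D : is_partition R m n D -> is_partition R n m D.
Proof.
move=> /is_partitionP[N [w [h [x [y [wh0 DE cov disj]]]]]].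
have rect_swap x' y' w' h' p :
    rect x' y' w' h' p <-> rect y' x' h' w' (p.2, p.1).
  by rewrite !rectP; split=> -[].
apply/is_partitionP; exists N, h, w, y, x; split.
- by move=> i; have [] := wh0 i.
- by rewrite DE; congr seq_mset; apply: eq_map => i; rewrite /rect_type minnC maxnC.
- move=> p; rewrite rect_swap -cov.
  by split=> -[i ip]; exists i; apply/rect_swap => //; rewrite -surjective_pairing.
- move=> i j p /interior_rectP[? ? ? ?] /interior_rectP[? ? ? ?].
  by apply: (disj i j (p.2, p.1)); apply/interior_rectP.
Qed.

(** The second tiling is translated up by [n1].  A tile of the first one then
    lies below the line at height [n1] and a tile of the second one above it, so
    tiles from different tilings overlap at most in that line. *)
Lemma is_partition_stack m n1 n2 D1 D2 :
  is_partition R m n1 D1 -> is_partition R m n2 D2 ->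
  is_partition R m (n1 + n2) (D1 `+` D2)%mset.
Proof.
move=> /is_partitionP[N1 [w1 [h1 [x1 [y1 [wh1 -> cov1 disj1]]]]]].
move=> /is_partitionP[N2 [w2 [h2 [x2 [y2 [wh2 -> cov2 disj2]]]]]].
pose glue T (f1 : 'I_N1 -> T) (f2 : 'I_N2 -> T) (i : 'I_(N1 + N2)) :=
  match fintype.split i with inl j => f1 j | inr j => f2 j end.
apply/is_partitionP; exists (N1 + N2)%N, (glue _ w1 w2), (glue _ h1 h2),
  (glue _ x1 x2), (glue _ y1 (fun j => y2 j + n1%:R)).
have gl T (f1 : 'I_N1 -> T) f2 j : glue T f1 f2 (lshift N2 j) = f1 j.
  by rewrite /glue (unsplitK (inl j)).
have gr T f1 (f2 : 'I_N2 -> T) j : glue T f1 f2 (rshift N1 j) = f2 j.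
  by rewrite /glue (unsplitK (inr j)).
have le1 i : [/\ 0 <= x1 i, x1 i + (w1 i)%:R <= m%:R, 0 <= y1 i
               & y1 i + (h1 i)%:R <= n1%:R].
  by apply: rect_le => p ip; apply/cov1; exists i.
have le2 i : [/\ 0 <= x2 i, x2 i + (w2 i)%:R <= m%:R, 0 <= y2 i
               & y2 i + (h2 i)%:R <= n2%:R].
  by apply: rect_le => p ip; apply/cov2; exists i.
have n1_ge0 : 0 <= n1%:R :> R by [].
have n2_ge0 : 0 <= n2%:R :> R by [].
split.
- by move=> i; case: (split_ordP i) => j ->; rewrite !(gl, gr).
- apply/msetP => a.
  rewrite msetE2 !seq_mset_ordE big_split_ord /=.
  by congr addn; apply: eq_bigr => i _; rewrite !(gl, gr).
- move=> p; split=> [[i]|].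
    case: (split_ordP i) => j ->; rewrite !(gl, gr) !rectP natrD.
      by have [? ? ? ?] := le1 j => -[? ? ? ?]; split; lra.
    by have [? ? ? ?] := le2 j => -[? ? ? ?]; split; lra.
  rewrite rectP natrD !add0r => -[p1 p2 p3 p4].
  have [p2n1|p2n1] := lerP p.2 n1%:R.
    have /cov1[i ip] : rect 0 0 m n1 p by apply/rectP; split; lra.
    by exists (lshift N2 i); rewrite !gl.
  have /cov2[i /rectP[/= *]] : rect 0 0 m n2 (p.1, p.2 - n1%:R).
    by apply/rectP; split=> /=; lra.
  by exists (rshift N1 i); rewrite !gr; apply/rectP; split; lra.
- move=> i j p; case: (split_ordP i) => i' ->; case: (split_ordP j) => j' ->;
    rewrite !(gl, gr) => /interior_rectP[? ? ? ?] /interior_rectP[? ? ? ?].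
  + by congr lshift; apply: (disj1 _ _ p); apply/interior_rectP.
  + exfalso; have [? ? ? ?] := le1 i'; have [? ? ? ?] := le2 j'; lra.
  + exfalso; have [? ? ? ?] := le1 j'; have [? ? ? ?] := le2 i'; lra.
  + congr rshift; apply: (disj2 _ _ (p.1, p.2 - n1%:R));
      by apply/interior_rectP; split=> /=; lra.
Qed.

(** Cutting the strip upright: stacking only works vertically, so horizontal
    rows are obtained from this one by transposition. *)
Lemma is_partition_strip s : s != [::] -> all (leq 1) s ->
  is_partition R 1 (sumn s) (seq_mset [seq rect_type l 1 | l <- s]).
Proof.
elim: s => //= l [|l' s] IHs _ /andP[l0 s0].
  by rewrite addn0; apply/is_partition_tr/is_partition1.
rewrite -(cat1s (rect_type l 1)) seq_mset_cat; apply: is_partition_stack; last exact: IHs.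
exact/is_partition_tr/is_partition1.
Qed.

Lemma is_partition_rows m (ss : seq (seq nat)) : (0 < m)%N -> ss != [::] ->
  all (fun s => all (leq 1) s && (sumn s == m)) ss ->
  is_partition R m (size ss) (seq_mset [seq rect_type l 1 | l <- flatten ss]).
Proof.
move=> m0; have strip s : all (leq 1) s && (sumn s == m) ->
    is_partition R m 1 (seq_mset [seq rect_type l 1 | l <- s]).
  move=> /andP[s0 /eqP sm]; apply/is_partition_tr; rewrite -sm.
  by apply: is_partition_strip => //; case: (s) sm m0 => // <-.
elim: ss => //= s [|s' ss] IHs _ /andP[s0 ss0].
  by rewrite cats0; apply: strip.
rewrite map_cat seq_mset_cat -(add1n (size _)).
by apply: is_partition_stack; [exact: strip | exact: IHs].
Qed.

(** * Finiteness of the set of partitions *)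

(** A tile contains every point above and to the right of its lower left corner
    [(x i, y i)], as far as the next integer coordinates, since its sides are at
    least 1.  So two tiles whose corners lie in the same unit cell of the grid
    overlap near the upper right corner of this cell; distinct tiles therefore
    have their corners in distinct cells. *)
Lemma num_tiles_le m n N (w h : 'I_N -> nat) (x y : 'I_N -> R) :
  (forall i, (0 < w i)%N /\ (0 < h i)%N) ->
  (forall i, rect (x i) (y i) (w i) (h i) `<=` rect 0 0 m n) ->
  (forall i j p, (rect (x i) (y i) (w i) (h i))° p ->
          (rect (x j) (y j) (w j) (h j))° p -> i = j) ->
  (N <= m * n)%N.
Proof.
move=> wh0 sub disj.
have pos1 k : (0 < k)%N -> 1 <= k%:R :> R by rewrite ler1n.
have bounds i : [/\ 0 <= x i, x i + 1 <= m%:R, 0 <= y i & y i + 1 <= n%:R].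
  have [? ? ? ?] := rect_le (sub i).
  have [/pos1 ? /pos1 ?] := wh0 i; split; lra.
have ltm i : (Num.truncn (x i) < m)%N.
  by have [? ? _ _] := bounds i; rewrite truncn_lt_nat //; lra.
have ltn i : (Num.truncn (y i) < n)%N.
  by have [_ _ ? ?] := bounds i; rewrite truncn_lt_nat //; lra.
pose f i := (Ordinal (ltm i), Ordinal (ltn i)).
suff /leq_card : injective f by rewrite card_prod !card_ord.
have meet (a b : R) (k l : nat) : 0 <= a -> 0 <= b ->
    Num.truncn a = Num.truncn b -> (0 < k)%N -> (0 < l)%N ->
    exists2 c, a < c < a + k%:R & b < c < b + l%:R.
  move=> a0 b0 eab /pos1 k1 /pos1 l1.
  have /andP[al ar] := truncn_itv a0; have /andP[bl br] := truncn_itv b0.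
  rewrite -eab in bl br; rewrite -natr1 in ar br.
  (* Midpoint of the larger of a, b and the right end of their common cell. *)
  exists ((Num.max a b + (Num.truncn a)%:R + 1) / 2);
    by case: (lerP a b) => ?; apply/andP; split; lra.
move=> i j [ex ey].
have [xi _ yi _] := bounds i; have [xj _ yj _] := bounds j.
have [wi hi] := wh0 i; have [wj hj] := wh0 j.
have [c /andP[? ?] /andP[? ?]] := meet _ _ _ _ xi xj ex wi wj.
have [d /andP[? ?] /andP[? ?]] := meet _ _ _ _ yi yj ey hi hj.
by apply: (disj _ _ (c, d)); apply/interior_rectP.
Qed.

Lemma finite_partitions m n : finite_set [set D | is_partition R m n D].
Proof.
pose S := {bseq (m * n) of 'I_m.+1 * 'I_n.+1}.
pose f (s : S) := seq_mset [seq rect_type (t : 'I_m.+1 * 'I_n.+1).1 t.2 | t <- bseqval s].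
apply: (@sub_finite_set _ _ (f @` setT)); last first.
  by apply: finite_image; apply: finite_finset.
move=> D /= /is_partitionP[N [w [h [x [y [wh0 DE cov disj]]]]]].
have sub i : rect (x i) (y i) (w i) (h i) `<=` rect 0 0 m n.
  by move=> p ip; apply/cov; exists i.
(* Every tile has sides at most m and n, so D is the image of a sequence of
   bounded length over a finite type. *)
have leN := num_tiles_le wh0 sub disj.
pose s := [seq (inord (w i) : 'I_m.+1, inord (h i) : 'I_n.+1) | i <- enum 'I_N].
have szs : (size s <= m * n)%N by rewrite size_map size_enum_ord.
exists (Bseq szs) => //; rewrite DE /f /= -map_comp.
congr seq_mset; apply: eq_map => i /=.
have [? ? ? ?] := rect_le (sub i).
by rewrite !inordK // ltnS -(ler_nat R); lra.
Qed.

End Tilings.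

(** * Encoding sequences of digits *)

Lemma rect_type1_inj : injective (rect_type ^~ 1%N).
Proof. by move=> k l [? ?]; lia. Qed.

Definition row n l a : seq nat := nseq a l ++ nseq (n - a * l) 1%N.

Lemma row_valid n l a : (0 < l)%N -> (a * l <= n)%N ->
  all (leq 1) (row n l a) && (sumn (row n l a) == n).
Proof.
move=> l0 an; rewrite /row all_cat !all_nseq l0 /= !orbT sumn_cat !sumn_nseq.
by apply/eqP; lia.
Qed.

Lemma count_row n l a l' : (1 < l')%N -> count_mem l' (row n l a) = ((l == l') * a)%N.
Proof.
move=> l'1; rewrite /row count_cat !count_nseq /=.
by rewrite (_ : (1%N == l') = false) ?addn0 //; lia.
Qed.

Section Encoding.
Variables n k : nat.
Implicit Type d : {ffun 'I_k -> 'I_5}.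

(** The digit [d i] is the number of bricks of length [i.+2]: length 1 is left
    to the tiles that fill the gaps.  At most two of the bricks go into the first
    of the two rows reserved for that length, and the remaining ones, at most two
    as well because [d i <= 4], into the second. *)
Definition digit_rows d : seq (seq nat) :=
  [seq row n i.+2 (minn (d i) 2) | i : 'I_k <- enum 'I_k] ++
  [seq row n i.+2 (d i - 2) | i : 'I_k <- enum 'I_k] ++
  nseq (n - k.*2) (row n 1 n).

Definition digit_mset d :=
  seq_mset [seq rect_type l 1 | l <- flatten (digit_rows d)].

Lemma digit_msetE d (i : 'I_k) : digit_mset d (rect_type i.+2 1) = d i.
Proof.
rewrite mset_seqE count_map (eq_count (a2 := pred1 i.+2)); last first.
  by move=> l /=; rewrite (inj_eq rect_type1_inj).
have countE (a : 'I_k -> nat) :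
    count_mem i.+2 (flatten [seq row n j.+2 (a j) | j : 'I_k <- enum 'I_k]) = a i.
  rewrite count_flatten sumnE 2!big_map big_enum /= (bigD1 i) //=.
  rewrite count_row // eqxx mul1n big1 ?addn0 // => j ji; rewrite count_row //.
  by rewrite !eqSS (inj_eq val_inj) (negbTE ji).
rewrite /digit_rows !flatten_cat !count_cat !countE count_flatten map_nseq.
rewrite count_row // mul0n sumn_nseq.
by lia.
Qed.

Lemma digit_mset_inj : injective digit_mset.
Proof.
by move=> d e de; apply/ffunP => i; apply/val_inj; rewrite /= -!digit_msetE de.
Qed.

(** If there are bricks at all, the longest have length [k.+1], and two of them
    must fit into a row; then the [k.*2] reserved rows fit as well. *)
Lemma digit_msetP (R : realType) d : (0 < n)%N -> (k.+1.*2 <= n \/ k = 0)%N ->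
  is_partition R n n (digit_mset d).
Proof.
move=> n0 kn; have szn : size (digit_rows d) = n.
  by rewrite !size_cat 2!size_map size_enum_ord size_nseq; lia.
have rows0 : digit_rows d != [::] by rewrite -size_eq0 szn -lt0n.
rewrite -{2}szn; apply: is_partition_rows => //.
have le2 (i : 'I_k) a : (a <= 2 -> a * i.+2 <= n)%N.
  by have := ltn_ord i; nia.
rewrite !all_cat; apply/and3P; split.
- by apply/allP => _ /mapP[i _ ->]; apply: row_valid => //; apply: le2; lia.
- apply/allP => _ /mapP[i _ ->]; apply: row_valid => //; apply: le2.
  by have := ltn_ord (d i); lia.
- by rewrite all_nseq row_valid ?orbT // muln1.
Qed.

End Encoding.

Lemma num_partitions_ge (R : realType) n : (0 < n)%N ->
  (5 ^ (n %/ 2).-1 <= num_partitions R n n)%N.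
Proof.
move=> n0; set k := (n %/ 2).-1.
have kn : (k.+1.*2 <= n \/ k = 0)%N by rewrite /k; lia.
have -> : (5 ^ k = #|{: {ffun 'I_k -> 'I_5}}|)%N by rewrite card_ffun !card_ord.
rewrite cardE -(size_map (@digit_mset n k)).
apply: uniq_leq_size.
  by rewrite map_inj_uniq ?enum_uniq //; exact: digit_mset_inj.
move=> D /mapP[d _ ->].
by rewrite in_fset_set ?inE; [exact: digit_msetP | exact: finite_partitions].
Qed.

Theorem theorem1p6 (R : realType) (n : nat) (hn : (0 < n)%N) :
  (5%:R : rat) ^ ((n %/ 2)%N%:Z - 2%:Z) <= (num_partitions R n n)%:R.
Proof.
apply: (@le_trans _ _ (5%:R ^ ((n %/ 2).-1)%:Z)).
  (* The exponents differ by 1, or by 2 when n = 1 and the predecessor is cut off. *)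
  by rewrite ler_eXz2l //; lia.
by rewrite -exprnP -natrX ler_nat; exact: num_partitions_ge.
Qed.
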